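(* Let $(N,\mu,\nu)$ be an intuitionistic fuzzy normed space, let $(u_k)_{k\ge 1}$ be a sequence in $N$ and let $a\in N$. If $(u_k)$ is statistically convergent to $a$ with respect to $(\mu,\nu)$ and $(u_k)$ is slowly oscillating, then $(u_k)$ is convergent to $a$ in $(N,\mu,\nu)$.
   Context: An intuitionistic fuzzy normed space (IFNS) is a triple $(N,\mu,\nu)$ where $N$ is a real vector space with zero vector $\theta$ and $\mu,\nu:N\times\mathbb{R}\to[0,1]$ satisfy, for all $u,w\in N$ and $t,s\in\mathbb{R}$: (a) $\mu(u,t)=0$ for $t\le 0$; (b) $\mu(u,t)=1$ for all $t>0$ if and only if $u=\theta$; (c) $\mu(cu,t)=\mu(u,t/|c|)$ for all $t>0$ and real $c\ne 0$; (d) $\mu(u+w,t+s)\ge\min\{\mu(u,t),\mu(w,s)\}$; (e) $\lim_{t\to\infty}\mu(u,t)=1$, and $\lim_{t\to 0}\mu(u,t)=0$ if $u\neq\theta$; (f) $\nu(u,t)=1$ for $t\le 0$; (g) $\nu(u,t)=0$ for all $t>0$ if and only if $u=\theta$; (h) $\nu(cu,t)=\nu(u,t/|c|)$ for all $t>0$ and real $c\neq 0$; (i) $\max\{\nu(u,t),\nu(w,s)\}\ge\nu(u+w,t+s)$; (j) $\lim_{t\to\infty}\nu(u,t)=0$, and $\lim_{t\to0}\nu(u,t)=1$ if $u\ne\theta$. A sequence $(u_k)$ in $N$ is convergent to $a\in N$ if for every $\varepsilon>0$ and $t>0$ there is $k_0\in\mathbb{N}$ such that $\mu(u_k-a,t)>1-\varepsilon$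 and $\nu(u_k-a,t)<\varepsilon$ for all $k\ge k_0$. $(u_k)$ is statistically convergent to $a\in N$ with respect to $(\mu,\nu)$ if for every $\varepsilon>0$ and $t>0$, $\lim_{n\to\infty}\frac1n\left|\{k\le n:\mu(u_k-a,t)\le 1-\varepsilon\text{ or }\nu(u_k-a,t)\ge\varepsilon\}\right|=0$. $(u_k)$ is slowly oscillating if for all $t>0$ and all $\varepsilon\in(0,1)$ there exist $\lambda>1$ and $m_0\in\mathbb{N}$ (depending on $t$ and $\varepsilon$) such that $\mu(u_k-u_n,t)>1-\varepsilon$ and $\nu(u_k-u_n,t)<\varepsilon$ whenever $m_0\le n<k\le\lfloor\lambda n\rfloor$. *)

(* Defs.v *)
From HB Require Import structures.
From mathcomp Require Import all_boot all_order all_algebra.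
From mathcomp Require Import all_classical all_reals all_analysis.
Set Implicit Arguments.
Unset Strict Implicit.
Unset Printing Implicit Defensive.
Import Order.TTheory GRing.Theory Num.Theory.
Import numFieldNormedType.Exports.
Local Open Scope classical_set_scope.
Local Open Scope ring_scope.

(* [is_ifns mu nu]: (N, mu, nu) is an intuitionistic fuzzy normed space.
   The limits at 0 are over the punctured neighbourhoods [0^']. *)
Record is_ifns (R : realType) (N : lmodType R) (mu nu : N -> R -> R) : Prop :=
  IsIfns {
    ifns_mu_itv : forall (u : N) (t : R), 0 <= mu u t <= 1;
    ifns_nu_itv : forall (u : N) (t : R), 0 <= nu u t <= 1;
    ifns_mu_le0 : forall (u : N) (t : R), t <= 0 -> mu u t = 0;
    ifns_mu_eq1 : forall u : N, (forall t : R, 0 < t -> mu u t = 1) <-> u = 0;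
    ifns_muZ : forall (u : N) (c t : R), 0 < t -> c != 0 ->
      mu (c *: u) t = mu u (t / `|c|);
    ifns_muD : forall (u w : N) (t s : R),
      Num.min (mu u t) (mu w s) <= mu (u + w) (t + s);
    ifns_mu_pinfty : forall u : N, mu u t @[t --> +oo] --> (1 : R);
    ifns_mu_0 : forall u : N, u != 0 -> mu u t @[t --> 0^'] --> (0 : R);
    ifns_nu_le0 : forall (u : N) (t : R), t <= 0 -> nu u t = 1;
    ifns_nu_eq0 : forall u : N, (forall t : R, 0 < t -> nu u t = 0) <-> u = 0;
    ifns_nuZ : forall (u : N) (c t : R), 0 < t -> c != 0 ->
      nu (c *: u) t = nu u (t / `|c|);
    ifns_nuD : forall (u w : N) (t s : R),
      nu (u + w) (t + s) <= Num.max (nu u t) (nu w s);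
    ifns_nu_pinfty : forall u : N, nu u t @[t --> +oo] --> (0 : R);
    ifns_nu_0 : forall u : N, u != 0 -> nu u t @[t --> 0^'] --> (1 : R)
  }.

(* Sequences (u_k)_{k >= 1} are functions u : nat -> N; none of the three
   notions below depends on the value u 0. *)

Definition ifn_convergent (R : realType) (N : lmodType R)
    (mu nu : N -> R -> R) (u : nat -> N) (a : N) : Prop :=
  forall eps t : R, 0 < eps -> 0 < t ->
  exists k0 : nat, forall k : nat, (k0 <= k)%N ->
    1 - eps < mu (u k - a) t /\ nu (u k - a) t < eps.

Definition ifn_stat_convergent (R : realType) (N : lmodType R)
    (mu nu : N -> R -> R) (u : nat -> N) (a : N) : Prop :=
  forall eps t : R, 0 < eps -> 0 < t ->
  (n%:R^-1 * #|[pred k : 'I_n.+1 | (1 <= k)%N &&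
       ((mu (u k - a) t <= 1 - eps) || (eps <= nu (u k - a) t))]|%:R : R)
    @[n --> \oo] --> (0 : R).

(* For n = 0 the range n < k <= floor (lambda * n) is empty, so allowing
   m0 = 0 is harmless. *)
Definition ifn_slowly_oscillating (R : realType) (N : lmodType R)
    (mu nu : N -> R -> R) (u : nat -> N) : Prop :=
  forall t eps : R, 0 < t -> 0 < eps < 1 ->
  exists (lambda : R) (m0 : nat), 1 < lambda /\
    forall n k : nat, (m0 <= n)%N -> (n < k)%N ->
      k%:Z <= Num.floor (lambda * n%:R) ->
      1 - eps < mu (u k - u n) t /\ nu (u k - u n) t < eps.

(* Main.v *)
Require Import Defs.
From HB Require Import structures.
From mathcomp Require Import all_boot all_order all_algebra.
From mathcomp Require Import all_classical all_reals all_analysis.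
From mathcomp Require Import zify lra.

(** If [k] is large, the indices [n < k] with [k <= lambda * n] form a positive
    proportion of the indices up to [k], so a set of density zero cannot contain
    all of them. Hence [u n] is close to [a] for one such [n], slow oscillation
    makes [u k] close to [u n], and the triangle inequality concludes. *)

Set Implicit Arguments.
Unset Strict Implicit.
Unset Printing Implicit Defensive.
Import Order.TTheory GRing.Theory Num.Theory.
Import numFieldNormedType.Exports.
Local Open Scope classical_set_scope.
Local Open Scope ring_scope.

(** Since [d < k], the block of [d] indices ending at [k - 1] avoids 0, so every one of them is
    counted. *)
Lemma leq_card_interval (B : pred nat) (d k : nat) :
  (d < k)%N ->
  (forall n, (k - d <= n)%N -> (n < k)%N -> B n) ->
  (d <= #|[pred i : 'I_k.+1 | (1 <= i)%N && B i]|)%N.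
Proof.
move=> dk hB.
pose f (i : 'I_d) : 'I_k.+1 := inord (k - d + i).
have fE (i : 'I_d) : f i = (k - d + i)%N :> nat.
  by rewrite inordK//; have := ltn_ord i; lia.
have finj : injective f.
  by move=> i j /(congr1 (@nat_of_ord _)); rewrite !fE => h; apply: val_inj => /=; lia.
rewrite -[X in (X <= _)%N](card_ord d) -(card_codom finj).
apply: subset_leq_card; apply/fintype.subsetP => _ /codomP[i ->].
rewrite inE /= fE; have := ltn_ord i => id.
by apply/andP; split; [lia | apply: hB; lia].
Qed.

(** For suitable [q], the last [k %/ q] indices before [k] satisfy [k <= lambda * n]. They are too
    numerous to lie all in [B], whose share up to [k] is eventually below [1 / (2 q)]. *)
Lemma density0_multiplicative_window (R : realType) (B : pred nat)
    (lambda : R) (m : nat) :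
  1 < lambda ->
  (n%:R^-1 * #|[pred i : 'I_n.+1 | (1 <= i)%N && B i]|%:R : R)
    @[n --> \oo] --> (0 : R) ->
  \forall k \near \oo,
    exists n, [/\ (m <= n)%N, (n < k)%N, k%:R <= lambda * n%:R & ~~ B n].
Proof.
move=> l1 B0.
(* The inequality amounts to [q >= lambda / (lambda - 1)]; with it, [n >= k (1 - 1/q)] forces
   [k <= lambda * n]. *)
have [q q2 hq] : exists2 q : nat, (2 <= q)%N & q%:R <= lambda * (q%:R - 1).
  exists (Num.bound ((lambda - 1)^-1 * lambda)).+2 => //.
  set b := Num.bound _.
  have : (lambda - 1)^-1 * lambda < b%:R.
    by apply: archi_boundP; rewrite mulr_ge0 ?invr_ge0; lra.
  rewrite ltr_pdivrMl ?subr_gt0// -addn2 natrD => h; nra.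
have q0 : (0 : R) < q%:R by rewrite ltr0n; lia.
(* The factor 2 absorbs the rounding in [k %/ q]. *)
have c0 : (0 : R) < (2 * q%:R)^-1 by rewrite invr_gt0 mulr_gt0.
have B_near := cvgr_lt _ B0 _ c0.
near=> k.
(* This bound gives [d >= 2] below; the next one gives [m <= n], because [q >= 2] puts the window
   above [k / 2]. *)
have kq : (2 * q <= k)%N by near: k; exact: nbhs_infty_ge.
have km : (2 * m <= k)%N by near: k; exact: nbhs_infty_ge.
have k0 : (0 : R) < k%:R by rewrite ltr0n; lia.
have hk : k%:R^-1 * #|[pred i : 'I_k.+1 | (1 <= i)%N && B i]|%:R
    < (2 * q%:R)^-1 :> R.
  by near: k; exact: B_near.
set d := (k %/ q)%N.
have dqk : (d * q <= k)%N by exact: leq_trunc_div.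
have kdq : (k < d.+1 * q)%N by rewrite ltn_ceil//; lia.
have d0 : (2 <= d)%N by rewrite leq_divRL//; lia.
apply: contrapT => hno.
have : (d <= #|[pred i : 'I_k.+1 | (1 <= i)%N && B i]|)%N.
  apply: leq_card_interval => [|n dn nk]; first by nia.
  apply/negPn/negP => nB; apply: hno; exists n; split => //; first by nia.
  have : (k * (q - 1) <= n * q)%N by nia.
  rewrite -(ler_nat R) !natrM natrB; last by lia.
  have q1 : (0 : R) < q%:R - 1 by rewrite subr_gt0 ltr1n.
  move=> h; rewrite -(ler_pM2r q1) mulrAC; apply: le_trans h _.
  by rewrite [leLHS]mulrC ler_wpM2r.
rewrite -(ler_nat R) => hd.
(* Here [k < (d + 1) q <= 2 d q], contradicting the density bound [d < k / (2 q)]. *)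
have : k%:R < 2 * q%:R * (d%:R : R).
  by rewrite -!natrM ltr_nat; nia.
have : d%:R < k%:R * (2 * q%:R : R)^-1.
  by apply: le_lt_trans hd _; rewrite -ltr_pdivrMl.
rewrite ltr_pdivlMr ?mulr_gt0// => h1 h2; nra.
Unshelve. all: by end_near. Qed.

Theorem theorem2p3 (R : realType) (N : lmodType R) (mu nu : N -> R -> R)
    (u : nat -> N) (a : N)
    (hN : is_ifns mu nu)
    (hstat : ifn_stat_convergent mu nu u a)
    (hslow : ifn_slowly_oscillating mu nu u) :
  ifn_convergent mu nu u a.
Proof.
move=> eps t eps0 t0.
(* Slow oscillation only accepts tolerances below 1, hence the cap at 1/2. *)
pose e : R := Num.min eps 2^-1.
have e0 : 0 < e by rewrite lt_min eps0/= invr_gt0.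
have e1 : e < 1 by rewrite gt_min; apply/orP; right; lra.
have ee : e <= eps by rewrite ge_min lexx.
have t20 : 0 < t / 2 by lra.
have [|lambda [m0 [l1 osc]]] := hslow (t / 2) e t20; first by rewrite e0.
have [k0 _ hk] := density0_multiplicative_window
  (B := fun k => (mu (u k - a) (t / 2) <= 1 - e) || (e <= nu (u k - a) (t / 2)))
  m0 l1 (hstat e (t / 2) e0 t20).
exists k0 => k /hk[n [m0n nk kn]].
rewrite negb_or -!ltNge => /andP[mun nun].
have [muk nuk] : 1 - e < mu (u k - u n) (t / 2) /\ nu (u k - u n) (t / 2) < e.
  by apply: osc => //; rewrite floor_ge_int.
have -> : u k - a = (u k - u n) + (u n - a) by rewrite addrA subrK.
rewrite [t]splitr; split.
  apply: lt_le_trans (ifns_muD hN _ _ _ _).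
  by rewrite lt_min; apply/andP; split; lra.
apply: le_lt_trans (ifns_nuD hN _ _ _ _) _.
by rewrite gt_max; apply/andP; split; lra.
Qed.
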